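(* Let $\mathbf D$ be the set of isomorphism types of finite double posets. With the product given by bilinearly extending the composition $(E,F)\mapsto EF$, the coproduct $\delta$ (the sum over all decompositions), the unit the empty double poset, the counit sending the empty double poset to $1$ and every other double poset to $0$, and the grading by number of elements, $\mathbb Z\mathbf D$ is a graded Hopf algebra over $\mathbb Z$. It is self-dual with respect to the Zelevinsky scalar product, i.e. for all double posets $E,F,G$, $$\langle EF,G\rangle=\langle E\otimes F,\delta(G)\rangle .$$
   Context: A double poset is a triple $(E,<_1,<_2)$, where $E$ is a finite set and $<_1,<_2$ are two (strict) partial orders on $E$, called the first and second order. Two double posets are isomorphic if there is a bijection between them that is an order isomorphism for the first orders and also for the second orders. Isomorphic double posets are identified; $\mathbf D$ is the set of isomorphism classes, and $\mathbb Z\mathbf D$ is the free $\mathbb Z$-module with basis $\mathbf D$. Composition: for double posets $E,F$, $EF$ is the double poset on the disjoint union $E\cup F$, where the first order extends the first orders of $E$ and $F$ with no element of $E$ being $<_1$-comparable to any element of $F$; and the second order extends the second orders of $E$ and $F$ together with the relations $e<_2 f$ for all $e\in E$, $f\in F$. Coproduct: an inferior ideal of a poset $(E,<)$ is a subset $I\subseteq E$ such that $y\in I$ and $x<y$ imply $x\in I$. A decomposition of a double poset $(E,<_1,<_2)$ is a pair $\big((I,<_1,<_2),(S,<_1,<_2)\big)$, where $I$ is an inferior ideal of $(E,<_1)$, $S=E\setminus I$, and the orders on $I$ and $S$ are the restrictions of those of $E$. The linear map $\delta:\mathbb Z\mathbf D\to\mathbb Z\mathbf D\otimes\mathbb Z\mathbf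 D$ is given on a double poset $E$ by $\delta(E)=\sum (I,<_1,<_2)\otimes(S,<_1,<_2)$, the sum being over all decompositions of $E$. Zelevinsky scalar product: a picture from a double poset $E$ to a double poset $F$ is a bijection $\phi:E\to F$ such that $e<_1e'$ implies $\phi(e)<_2\phi(e')$ for all $e,e'\in E$, and $f<_1f'$ implies $\phi^{-1}(f)<_2\phi^{-1}(f')$ for all $f,f'\in F$. The pairing $\langle\,,\rangle$ on $\mathbb Z\mathbf D$ is the bilinear extension of $\langle E,F\rangle=$ the number of pictures from $E$ to $F$; on $\mathbb Z\mathbf D\otimes\mathbb Z\mathbf D$ it is given by $\langle a\otimes b,c\otimes d\rangle=\langle a,c\rangle\langle b,d\rangle$. *)

(* Defs.v *)
From HB Require Import structures.
From mathcomp Require Import all_boot all_order all_algebra.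
From mathcomp Require Import finmap.
From mathcomp.multinomials Require Import monalg.

Set Implicit Arguments.
Unset Strict Implicit.
Unset Printing Implicit Defensive.

Import GRing.Theory.
Local Open Scope ring_scope.
Local Open Scope quotient_scope.

(* Z-modules are zmodTypes and Z-linear maps are additive maps.  The free
   Z-module with basis K is {malg int[K]}; its basis vectors are << k >>. *)

Section FreeModule.
Context {K : choiceType} {M : zmodType}.

Definition lin (f : K -> M) (a : {malg int[K]}) : M :=
  \sum_(k <- msupp a) f k *~ a@_k.

Lemma linEw (f : K -> M) (d : {fset K}) (a : {malg int[K]}) :
  (msupp a `<=` d)%fset -> lin f a = \sum_(k <- d) f k *~ a@_k.
Proof.
move=> le_ad; rewrite /lin (big_fset_incl _ le_ad) //= => k _ kNa.
by rewrite (mcoeff_outdom kNa) mulr0z.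
Qed.

Lemma linD (f : K -> M) : {morph lin f : a b / a + b}.
Proof.
move=> a b; pose d := (msupp a `|` msupp b)%fset.
rewrite (linEw f (d := d)) ?msuppD_le // (linEw f (d := d) (a := a)) ?fsubsetUl //.
rewrite (linEw f (d := d) (a := b)) ?fsubsetUr // -big_split /=.
by apply: eq_bigr => k _; rewrite mcoeffD mulrzDr.
Qed.

Lemma linU (f : K -> M) k : lin f << k >> = f k.
Proof.
by rewrite (linEw f (d := [fset k]%fset)) ?msuppU_le // big_seq_fset1 mcoeffUU.
Qed.

Lemma lin_unique (f : K -> M) (g : {malg int[K]} -> M) :
  {morph g : a b / a + b} -> (forall k, g << k >> = f k) -> g =1 lin f.
Proof.
move=> gD gU a.
have g0 : g 0 = 0 by apply: (addrI (g 0)); rewrite -gD !addr0.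
have gN b : g (- b) = - g b by apply: (addrI (g b)); rewrite -gD !subrr g0.
have gMn b n : g (b *+ n) = g b *+ n.
  by elim: n => [|n IHn]; rewrite ?mulr0n // !mulrS gD IHn.
have gMz b z : g (b *~ z) = g b *~ z.
  by case: z => n; rewrite ?NegzE ?mulrNz ?gN -!pmulrn gMn.
rewrite {1}(monalgE a) (big_morph g gD g0); apply: eq_bigr => k _.
by rewrite -gU -gMz -(raddfMz (@mkmalgU K int k)) intz.
Qed.

End FreeModule.

(* The tensor product of the free modules on K and L is the free module on
   K * L; lemmas tliftE, tliftD and tlift_unique are its universal property. *)

Definition tens {K L : choiceType} (a : {malg int[K]}) (b : {malg int[L]}) :
    {malg int[(K * L)%type]} :=
  lin (fun k => lin (fun l => << (k, l) >>) b) a.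

Notation "a \ot b" := (tens a b) (at level 40, left associativity).

Definition biadditive (A B M : zmodType) (h : A -> B -> M) : Prop :=
  (forall b, {morph h^~ b : a a' / a + a'}) /\
  (forall a, {morph h a : b b' / b + b'}).

(* The linear map induced by a bilinear map h. *)
Definition tlift {K L : choiceType} {M : zmodType}
    (h : {malg int[K]} -> {malg int[L]} -> M) (x : {malg int[(K * L)%type]}) : M :=
  lin (fun kl => h << kl.1 >> << kl.2 >>) x.

Section Tensor.
Context {K L : choiceType} {M : zmodType}.
Implicit Type h : {malg int[K]} -> {malg int[L]} -> M.

Lemma lin_sumf (J : choiceType) (N : zmodType) (f g : J -> N) a :
  lin (fun j => f j + g j) a = lin f a + lin g a.
Proof. by rewrite -big_split; apply: eq_bigr => j _; rewrite mulrzDl. Qed.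

Lemma eq_lin (J : choiceType) (N : zmodType) (f g : J -> N) :
  f =1 g -> lin f =1 lin g.
Proof. by move=> fg a; apply: eq_bigr => j _; rewrite fg. Qed.

Lemma tensD : biadditive (@tens K L).
Proof.
split=> [b|a] x y; first exact: linD.
by rewrite /tens -lin_sumf; apply: eq_lin => k; exact: linD.
Qed.

Lemma tensU (k : K) (l : L) : << k >> \ot << l >> = << (k, l) >>.
Proof. by rewrite /tens !linU. Qed.

Lemma tliftD h : {morph tlift h : x y / x + y}.
Proof. exact: linD. Qed.

Lemma tliftU h k l : tlift h << (k, l) >> = h << k >> << l >>.
Proof. exact: linU. Qed.

Lemma tliftE h a b : biadditive h -> tlift h (a \ot b) = h a b.
Proof.
move=> [hDl hDr].
have hb k : h << k >> b = tlift h (<< k >> \ot b).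
  rewrite (lin_unique (hDr _) (fun=> erefl) b).
  symmetry; apply: (lin_unique (g := fun b => tlift h (<< k >> \ot b))).
    by move=> x y /=; rewrite (tensD.2 _) tliftD.
  by move=> l; rewrite tensU tliftU.
rewrite (lin_unique (g := h^~ b) (hDl b) (fun=> erefl) a).
apply: (lin_unique (g := fun a => tlift h (a \ot b))) => [x y|k] /=.
  by rewrite (tensD.1 _) tliftD.
by rewrite -hb.
Qed.

Lemma tlift_unique h (g : {malg int[(K * L)%type]} -> M) :
  {morph g : x y / x + y} -> (forall a b, g (a \ot b) = h a b) -> g =1 tlift h.
Proof.
by move=> gD gE; apply: lin_unique => // -[k l]; rewrite -tensU gE.
Qed.

End Tensor.

Section GradedHopfAlgebra.
Variable K : choiceType.
Local Notation A := {malg int[K]}.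

Definition tassoc : {malg int[(K * (K * K))%type]} -> {malg int[(K * K * K)%type]} :=
  tlift (fun a => tlift (fun b c => a \ot b \ot c)).

Definition tmul (mul : A -> A -> A) (x y : {malg int[(K * K)%type]}) :
    {malg int[(K * K)%type]} :=
  tlift (fun a b => tlift (fun c d => mul a c \ot mul b d) y) x.

Record is_algebra (mul : A -> A -> A) (one : A) : Prop := IsAlgebra {
  alg_mul_bilinear : biadditive mul;
  alg_mulA : associative mul;
  alg_mul1 : left_id one mul;
  alg_mulr1 : right_id one mul }.

Record is_coalgebra (delta : A -> {malg int[(K * K)%type]}) (eps : A -> int) : Prop :=
  IsCoalgebra {
  coalg_delta_linear : {morph delta : a b / a + b};
  coalg_eps_linear : {morph eps : a b / a + b};
  coalg_coassoc : forall a,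
    tlift (fun b c => delta b \ot c) (delta a)
    = tassoc (tlift (fun b c => b \ot delta c) (delta a));
  coalg_counitl : forall a, tlift (fun b c => c *~ eps b) (delta a) = a;
  coalg_counitr : forall a, tlift (fun b c => b *~ eps c) (delta a) = a }.

Record is_bialgebra (mul : A -> A -> A) (one : A)
    (delta : A -> {malg int[(K * K)%type]}) (eps : A -> int) : Prop := IsBialgebra {
  bialg_algebra : is_algebra mul one;
  bialg_coalgebra : is_coalgebra delta eps;
  bialg_deltaM : forall a b, delta (mul a b) = tmul mul (delta a) (delta b);
  bialg_delta1 : delta one = one \ot one;
  bialg_epsM : forall a b, eps (mul a b) = eps a * eps b;
  bialg_eps1 : eps one = 1 }.

Record is_antipode (mul : A -> A -> A) (one : A)
    (delta : A -> {malg int[(K * K)%type]}) (eps : A -> int) (S : A -> A) : Prop :=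
  IsAntipode {
  antipode_linear : {morph S : a b / a + b};
  antipodel : forall a, tlift (fun b c => mul (S b) c) (delta a) = one *~ eps a;
  antipoder : forall a, tlift (fun b c => mul b (S c)) (delta a) = one *~ eps a }.

Record is_grading (gr : nat -> A -> Prop) : Prop := IsGrading {
  gr0 : forall n, gr n 0;
  grB : forall n a b, gr n a -> gr n b -> gr n (a - b);
  gr_span : forall a, exists (n : nat) (f : nat -> A),
    (forall i, gr i (f i)) /\ a = \sum_(i < n) f i;
  gr_direct : forall (n : nat) (f : nat -> A),
    (forall i, gr i (f i)) -> \sum_(i < n) f i = 0 ->
    forall i : 'I_n, f i = 0 }.

(* Membership in the degree n part of the tensor square, the sum of the
   gr i \ot gr j over i + j = n. *)
Definition tgr (gr : nat -> A -> Prop) (n : nat) (x : {malg int[(K * K)%type]}) : Prop :=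
  exists (m : nat) (i : 'I_m -> nat) (a b : 'I_m -> A),
    (forall k, [/\ (i k <= n)%N, gr (i k) (a k) & gr (n - i k)%N (b k)]) /\
    x = \sum_(k < m) a k \ot b k.

(* The structure maps, including the antipode, are homogeneous of degree 0;
   int is concentrated in degree 0. *)
Record is_graded_hopf_algebra (mul : A -> A -> A) (one : A)
    (delta : A -> {malg int[(K * K)%type]}) (eps : A -> int)
    (gr : nat -> A -> Prop) : Prop := IsGradedHopfAlgebra {
  ghopf_bialgebra : is_bialgebra mul one delta eps;
  ghopf_grading : is_grading gr;
  ghopf_grM : forall i j a b, gr i a -> gr j b -> gr (i + j)%N (mul a b);
  ghopf_gr1 : gr 0%N one;
  ghopf_gr_delta : forall n a, gr n a -> tgr gr n (delta a);
  ghopf_gr_eps : forall n a, gr n a -> n <> 0%N -> eps a = 0;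
  ghopf_antipode : exists S : A -> A,
    is_antipode mul one delta eps S /\ (forall n a, gr n a -> gr n (S a)) }.

End GradedHopfAlgebra.

Section DoublePoset.

Definition strict_order (T : finType) (R : {set T * T}) : bool :=
  [forall x, (x, x) \notin R] &&
  [forall x, forall y, forall z,
     ((x, y) \in R) && ((y, z) \in R) ==> ((x, z) \in R)].

Lemma strict_orderP (T : finType) (R : {set T * T}) :
  reflect ((forall x, (x, x) \notin R) /\
           (forall x y z, (x, y) \in R -> (y, z) \in R -> (x, z) \in R))
          (strict_order R).
Proof.
apply: (iffP andP) => -[irrR trR].
  split=> [x|x y z xy yz]; first exact: (forallP irrR x).
  move: trR => /forallP/(_ x)/forallP/(_ y)/forallP/(_ z)/implyP.
  by apply; rewrite xy.
split; first exact/forallP.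
apply/forallP => x; apply/forallP => y; apply/forallP => z.
by apply/implyP => /andP[]; apply: trR.
Qed.

Record dposet (T : finType) := DPoset {
  dprels : {set T * T} * {set T * T};
  dprelsP : strict_order dprels.1 && strict_order dprels.2 }.

HB.instance Definition _ (T : finType) := [isSub for @dprels T].
HB.instance Definition _ (T : finType) := [Finite of dposet T by <:].

Definition lt1 (T : finType) (P : dposet T) : rel T :=
  fun x y => (x, y) \in (dprels P).1.
Definition lt2 (T : finType) (P : dposet T) : rel T :=
  fun x y => (x, y) \in (dprels P).2.

Lemma dposet_rels (T : finType) (r1 r2 : rel T) :
  irreflexive r1 -> transitive r1 -> irreflexive r2 -> transitive r2 ->
  strict_order [set u | r1 u.1 u.2] && strict_order [set u | r2 u.1 u.2].
Proof.
move=> i1 t1 i2 t2; apply/andP; split; apply/strict_orderP.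
- by split=> [x|x y z]; rewrite !inE ?i1 //; apply: t1.
- by split=> [x|x y z]; rewrite !inE ?i2 //; apply: t2.
Qed.

Definition mk_dposet (T : finType) (r1 r2 : rel T)
    (i1 : irreflexive r1) (t1 : transitive r1)
    (i2 : irreflexive r2) (t2 : transitive r2) : dposet T :=
  @DPoset T ([set u | r1 u.1 u.2], [set u | r2 u.1 u.2])
    (dposet_rels i1 t1 i2 t2).

Lemma lt1_mk T r1 r2 i1 t1 i2 t2 x y :
  lt1 (@mk_dposet T r1 r2 i1 t1 i2 t2) x y = r1 x y.
Proof. by rewrite /lt1 inE. Qed.

Lemma lt2_mk T r1 r2 i1 t1 i2 t2 x y :
  lt2 (@mk_dposet T r1 r2 i1 t1 i2 t2) x y = r2 x y.
Proof. by rewrite /lt2 inE. Qed.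

Lemma lt1_irr (T : finType) (P : dposet T) : irreflexive (lt1 P).
Proof.
by case/andP: (dprelsP P) => /strict_orderP[H _] _ x; exact: (negbTE (H x)).
Qed.

Lemma lt2_irr (T : finType) (P : dposet T) : irreflexive (lt2 P).
Proof.
by case/andP: (dprelsP P) => _ /strict_orderP[H _] x; exact: (negbTE (H x)).
Qed.

Lemma lt1_trans (T : finType) (P : dposet T) : transitive (lt1 P).
Proof.
by case/andP: (dprelsP P) => /strict_orderP[_ H] _ y x z; apply: H.
Qed.

Lemma lt2_trans (T : finType) (P : dposet T) : transitive (lt2 P).
Proof.
by case/andP: (dprelsP P) => _ /strict_orderP[_ H] y x z; apply: H.
Qed.

(* The orders pulled back along f. *)
Section Pullback.
Variables (T U : finType) (f : U -> T) (P : dposet T).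

Definition dpull : dposet U :=
  @mk_dposet U (fun x y => lt1 P (f x) (f y)) (fun x y => lt2 P (f x) (f y))
    (fun x => lt1_irr P (f x)) (fun y x z => @lt1_trans _ P (f y) (f x) (f z))
    (fun x => lt2_irr P (f x)) (fun y x z => @lt2_trans _ P (f y) (f x) (f z)).

End Pullback.

Definition drestr (T : finType) (P : dposet T) (I : {set T}) :
    dposet {x : T | x \in I} :=
  dpull (fun x : {x : T | x \in I} => val x) P.

Section Composition.
Variables (T U : finType) (P : dposet T) (Q : dposet U).

Definition comp_lt1 (x y : T + U) : bool :=
  match x, y with
  | inl a, inl b => lt1 P a b
  | inr a, inr b => lt1 Q a b
  | _, _ => false
  end.

Definition comp_lt2 (x y : T + U) : bool :=
  match x, y with
  | inl a, inl b => lt2 P a b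
  | inr a, inr b => lt2 Q a b
  | inl _, inr _ => true
  | inr _, inl _ => false
  end.

Lemma comp_lt1_irr : irreflexive comp_lt1.
Proof. by case=> x /=; rewrite lt1_irr. Qed.

Lemma comp_lt2_irr : irreflexive comp_lt2.
Proof. by case=> x /=; rewrite lt2_irr. Qed.

Lemma comp_lt1_trans : transitive comp_lt1.
Proof. by case=> y [] x [] z //=; apply: lt1_trans. Qed.

Lemma comp_lt2_trans : transitive comp_lt2.
Proof. by case=> y [] x [] z //=; apply: lt2_trans. Qed.

Definition dcomp : dposet (T + U)%type :=
  mk_dposet comp_lt1_irr comp_lt1_trans comp_lt2_irr comp_lt2_trans.

End Composition.

Definition dempty : dposet void :=
  @mk_dposet void (fun _ _ => false) (fun _ _ => false)
    (fun=> erefl) (fun _ _ _ _ => id) (fun=> erefl) (fun _ _ _ _ => id).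

Definition lower_ideal (T : finType) (P : dposet T) (I : {set T}) : bool :=
  [forall x, forall y, (y \in I) && lt1 P x y ==> (x \in I)].

Definition mutual_inverses (T U : finType) (f : T -> U) (g : U -> T) : bool :=
  [forall x, g (f x) == x] && [forall y, f (g y) == y].

Lemma mutual_inversesP (T U : finType) (f : T -> U) (g : U -> T) :
  reflect (cancel f g /\ cancel g f) (mutual_inverses f g).
Proof.
apply: (iffP andP) => -[fg gf]; split.
- by move=> x; apply/eqP/(forallP fg).
- by move=> x; apply/eqP/(forallP gf).
- by apply/forallP => x; rewrite fg.
- by apply/forallP => x; rewrite gf.
Qed.

Definition diso (T U : finType) (P : dposet T) (Q : dposet U) : bool :=
  [exists f : {ffun T -> U}, exists g : {ffun U -> T},
    [&& mutual_inverses f g,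
        [forall x, forall y, lt1 P x y == lt1 Q (f x) (f y)] &
        [forall x, forall y, lt2 P x y == lt2 Q (f x) (f y)]]].

Definition picture (T U : finType) (P : dposet T) (Q : dposet U)
    (f : {ffun T -> U}) : bool :=
  [exists g : {ffun U -> T},
    [&& mutual_inverses f g,
        [forall x, forall y, lt1 P x y ==> lt2 Q (f x) (f y)] &
        [forall x, forall y, lt1 Q x y ==> lt2 P (g x) (g y)]]].

Definition npictures (T U : finType) (P : dposet T) (Q : dposet U) : nat :=
  #|[set f : {ffun T -> U} | picture P Q f]|.

Lemma disoP (T U : finType) (P : dposet T) (Q : dposet U) :
  reflect (exists f : T -> U, exists g : U -> T,
             [/\ cancel f g, cancel g f,
                 (forall x y, lt1 P x y = lt1 Q (f x) (f y)) &
                 (forall x y, lt2 P x y = lt2 Q (f x) (f y))])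
          (diso P Q).
Proof.
apply: (iffP existsP) => [[f /existsP[g]]|[f [g [fK gK f1 f2]]]].
  case/and3P=> /mutual_inversesP[fK gK] f1 f2; exists f, g; split=> // x y.
  - by apply/eqP; move: f1 => /forallP/(_ x)/forallP/(_ y).
  - by apply/eqP; move: f2 => /forallP/(_ x)/forallP/(_ y).
exists (finfun f); apply/existsP; exists (finfun g); apply/and3P; split.
- by apply/mutual_inversesP; split=> x; rewrite !ffunE ?fK ?gK.
- by apply/forallP => x; apply/forallP => y; rewrite !ffunE f1.
- by apply/forallP => x; apply/forallP => y; rewrite !ffunE f2.
Qed.

Lemma pictureP (T U : finType) (P : dposet T) (Q : dposet U)
    (f : {ffun T -> U}) :
  reflect (exists g : U -> T,
             [/\ cancel f g, cancel g f,
                 (forall x y, lt1 P x y -> lt2 Q (f x) (f y)) &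
                 (forall x y, lt1 Q x y -> lt2 P (g x) (g y))])
          (picture P Q f).
Proof.
apply: (iffP existsP) => [[g]|[g [fK gK f1 f2]]].
  case/and3P=> /mutual_inversesP[fK gK] f1 f2; exists g; split=> // x y.
  - by apply/implyP; move: f1 => /forallP/(_ x)/forallP/(_ y).
  - by apply/implyP; move: f2 => /forallP/(_ x)/forallP/(_ y).
exists (finfun g); apply/and3P; split.
- by apply/mutual_inversesP; split=> x; rewrite ?ffunE ?fK ?gK.
- by apply/forallP => x; apply/forallP => y; apply/implyP; apply: f1.
- by apply/forallP => x; apply/forallP => y; apply/implyP; rewrite !ffunE; apply: f2.
Qed.

Lemma diso_refl (T : finType) (P : dposet T) : diso P P.
Proof. by apply/disoP; exists id, id. Qed.

Lemma diso_sym (T U : finType) (P : dposet T) (Q : dposet U) :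
  diso P Q -> diso Q P.
Proof.
move/disoP=> [f [g [fK gK f1 f2]]]; apply/disoP; exists g, f.
by split=> // x y; rewrite ?f1 ?f2 !gK.
Qed.

Lemma diso_trans (T U V : finType) (P : dposet T) (Q : dposet U)
    (R : dposet V) : diso P Q -> diso Q R -> diso P R.
Proof.
move=> /disoP[f [g [fK gK f1 f2]]] /disoP[f' [g' [fK' gK' f1' f2']]].
apply/disoP; exists (f' \o f), (g \o g').
split; [exact: can_comp | exact: can_comp | |] => x y /=.
- by rewrite f1 f1'.
- by rewrite f2 f2'.
Qed.

Lemma dpull_iso (T U : finType) (P : dposet T) (f : U -> T) (g : T -> U) :
  cancel f g -> cancel g f -> diso (dpull f P) P.
Proof.
move=> fK gK; apply/disoP; exists f, g.
by split=> // x y; rewrite ?lt1_mk ?lt2_mk.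
Qed.

Lemma dcomp_iso (T U T' U' : finType) (P : dposet T) (Q : dposet U)
    (P' : dposet T') (Q' : dposet U') :
  diso P P' -> diso Q Q' -> diso (dcomp P Q) (dcomp P' Q').
Proof.
move=> /disoP[f [g [fK gK f1 f2]]] /disoP[f' [g' [fK' gK' f1' f2']]].
pose h (x : T + U) := match x with inl a => inl (f a) | inr b => inr (f' b) end.
pose k (x : T' + U') := match x with inl a => inl (g a) | inr b => inr (g' b) end.
apply/disoP; exists h, k; split.
- by case=> x /=; rewrite ?fK ?fK'.
- by case=> x /=; rewrite ?gK ?gK'.
- by case=> x [] y; rewrite !lt1_mk /= ?f1 ?f1'.
- by case=> x [] y; rewrite !lt2_mk /= ?f2 ?f2'.
Qed.

Lemma npictures_iso (T U T' U' : finType) (P : dposet T) (Q : dposet U)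
    (P' : dposet T') (Q' : dposet U') :
  diso P P' -> diso Q Q' -> npictures P Q = npictures P' Q'.
Proof.
have le_np (T1 U1 T2 U2 : finType) (P1 : dposet T1) (Q1 : dposet U1)
    (P2 : dposet T2) (Q2 : dposet U2) :
    diso P1 P2 -> diso Q1 Q2 -> (npictures P1 Q1 <= npictures P2 Q2)%N.
  move=> /disoP[f [g [fK gK f1 f2]]] /disoP[f' [g' [fK' gK' f1' f2']]].
  pose F (h : {ffun T1 -> U1}) : {ffun T2 -> U2} := [ffun x => f' (h (g x))].
  have injF : injective F.
    move=> h h' /ffunP eqF; apply/ffunP => x.
    by have := eqF (f x); rewrite !ffunE fK => /(can_inj fK').
  rewrite /npictures -(card_imset _ injF); apply/subset_leq_card/subsetP => h'.
  case/imsetP=> h; rewrite inE => /pictureP[k [hK kK h1 h2]] ->.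
  rewrite inE; apply/pictureP; exists (f \o k \o g'); split.
  - by move=> x; rewrite ffunE /= fK' hK gK.
  - by move=> x; rewrite ffunE /= fK kK gK'.
  - by move=> x y xy; rewrite !ffunE -f2' h1 // f1 !gK.
  - by move=> x y xy; rewrite /= -f2 h2 // f1' !gK'.
move=> PP QQ; apply/eqP; rewrite eqn_leq le_np //=.
by apply: le_np; apply: diso_sym.
Qed.

End DoublePoset.

(* Every finite double poset is isomorphic to one on some 'I_n, so
   isomorphism classes are a quotient of {n : nat & dposet 'I_n}. *)

Definition ord_dposet : Type := {n : nat & dposet 'I_n}.
HB.instance Definition _ := Choice.on ord_dposet.

Definition ord_diso (P Q : ord_dposet) : bool := diso (tagged P) (tagged Q).

Lemma ord_diso_refl : reflexive ord_diso.
Proof. by move=> P; apply: diso_refl. Qed.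
Lemma ord_diso_sym : symmetric ord_diso.
Proof. by move=> P Q; apply/idP/idP; apply: diso_sym. Qed.
Lemma ord_diso_trans : transitive ord_diso.
Proof. by move=> Q P R; apply: diso_trans. Qed.

Canonical ord_diso_equiv :=
  EquivRel ord_diso ord_diso_refl ord_diso_sym ord_diso_trans.

Definition dclass : Type := {eq_quot ord_diso}.
HB.instance Definition _ := Choice.on dclass.
HB.instance Definition _ := EqQuotient.on dclass.

Definition dsize (x : dclass) : nat := tag (repr x).
Definition drepr (x : dclass) : dposet 'I_(dsize x) := tagged (repr x).

Definition dcls (T : finType) (P : dposet T) : dclass :=
  \pi_dclass (Tagged (fun n => dposet 'I_n) (dpull (@enum_val T predT) P)).

Lemma drepr_iso (T : finType) (P : dposet T) : diso (drepr (dcls P)) P.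
Proof.
have PP : diso (dpull (@enum_val T predT) P) P.
  by apply: (dpull_iso _ (g := @enum_rank T)); [apply: enum_valK | apply: enum_rankK].
apply: diso_trans PP.
have : repr (dcls P) == Tagged (fun n => dposet 'I_n) (dpull (@enum_val T predT) P)
    %[mod dclass] by rewrite reprK.
by rewrite eqmodE.
Qed.

Lemma dreprK (x : dclass) : dcls (drepr x) = x.
Proof.
rewrite -[RHS]reprK; apply/eqP; rewrite eqmodE.
by apply: (dpull_iso _ (g := @enum_rank _)); [apply: enum_valK | apply: enum_rankK].
Qed.

Lemma dclsP (T U : finType) (P : dposet T) (Q : dposet U) :
  reflect (dcls P = dcls Q) (diso P Q).
Proof.
apply: (iffP idP) => [PQ|PQ]; last first.
  by apply: (diso_trans (diso_sym (drepr_iso P))); rewrite PQ; apply: drepr_iso.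
have isoP V (R : dposet V) : diso (dpull (@enum_val V predT) R) R.
  by apply: (dpull_iso _ (g := @enum_rank V)); [apply: enum_valK | apply: enum_rankK].
apply/eqP; rewrite eqmodE; apply: (diso_trans (isoP _ P)).
exact/(diso_trans PQ)/diso_sym/isoP.
Qed.

Lemma dsize_cls (T : finType) (P : dposet T) : dsize (dcls P) = #|T|.
Proof.
have /disoP[f [g [fK gK _ _]]] := drepr_iso P.
by rewrite -(bij_eq_card (Bijective fK gK)) card_ord.
Qed.

Local Notation ZD := {malg int[dclass]}.
Local Notation ZD2 := {malg int[(dclass * dclass)%type]}.

Definition zd (T : finType) (P : dposet T) : ZD := << dcls P >>.

Definition zd_mul (a b : ZD) : ZD :=
  lin (fun x => lin (fun y => zd (dcomp (drepr x) (drepr y))) b) a.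

Definition zd_one : ZD := zd dempty.

Definition decompositions (T : finType) (P : dposet T) : ZD2 :=
  \sum_(I : {set T} | lower_ideal P I) zd (drestr P I) \ot zd (drestr P (~: I)).

Definition zd_delta : ZD -> ZD2 := lin (fun x => decompositions (drepr x)).

Definition zd_counit : ZD -> int := lin (fun x => (x == dcls dempty)%:R).

Definition zd_grade (n : nat) (a : ZD) : Prop :=
  forall x, x \in msupp a -> dsize x = n.

Definition zd_pair (a b : ZD) : int :=
  lin (fun x => lin (fun y => (npictures (drepr x) (drepr y))%:Z) b) a.

Definition zd_pair2 (x y : ZD2) : int :=
  tlift (fun a b => tlift (fun c d => zd_pair a c * zd_pair b d) y) x.

(* The operations do not depend on the choice of representatives. *)

Lemma zd_iso (T U : finType) (P : dposet T) (Q : dposet U) :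
  diso P Q -> zd P = zd Q.
Proof. by move/dclsP=> PQ; rewrite /zd PQ. Qed.

Lemma zd_mulE (T U : finType) (P : dposet T) (Q : dposet U) :
  zd_mul (zd P) (zd Q) = zd (dcomp P Q).
Proof.
rewrite /zd_mul !linU; apply: zd_iso.
by apply: dcomp_iso; apply: drepr_iso.
Qed.

Lemma drestr_iso (T U : finType) (P : dposet T) (Q : dposet U)
    (f : T -> U) (g : U -> T) (I : {set T}) (J : {set U}) :
  cancel f g -> cancel g f ->
  (forall x y, lt1 P x y = lt1 Q (f x) (f y)) ->
  (forall x y, lt2 P x y = lt2 Q (f x) (f y)) ->
  (forall x, (f x \in J) = (x \in I)) ->
  diso (drestr P I) (drestr Q J).
Proof.
move=> fK gK f1 f2 fI.
have fJ (x : {x | x \in I}) : f (val x) \in J by rewrite fI (valP x).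
have gI (y : {y | y \in J}) : g (val y) \in I by rewrite -fI gK (valP y).
apply/disoP.
exists (fun x => exist (fun y => y \in J) _ (fJ x)),
       (fun y => exist (fun x => x \in I) _ (gI y)).
split.
- by move=> x; apply: val_inj => /=; rewrite fK.
- by move=> x; apply: val_inj => /=; rewrite gK.
- by move=> x y; rewrite !lt1_mk f1.
- by move=> x y; rewrite !lt2_mk f2.
Qed.

Lemma decompositions_iso (T U : finType) (P : dposet T) (Q : dposet U) :
  diso P Q -> decompositions P = decompositions Q.
Proof.
move=> /disoP[f [g [fK gK f1 f2]]].
have preK : cancel (fun J : {set U} => f @^-1: J) (fun I : {set T} => g @^-1: I).
  by move=> J; apply/setP => y; rewrite !inE gK.
have preK' : cancel (fun I : {set T} => g @^-1: I) (fun J : {set U} => f @^-1: J).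
  by move=> J; apply/setP => y; rewrite !inE fK.
rewrite /decompositions (reindex (fun J : {set U} => f @^-1: J)); last first.
  by exists (fun I : {set T} => g @^-1: I) => I _.
apply: eq_big => [J|J _].
  apply/forallP/forallP => low x; apply/forallP => y; apply/implyP.
    move=> /andP[yJ xy]; move/forallP: (low (g x)) => /(_ (g y)).
    by rewrite !inE f1 !gK yJ xy.
  rewrite !inE f1 => yx; move/forallP: (low (f x)) => /(_ (f y)).
  by rewrite yx.
have isoJ (J' : {set U}) : zd (drestr P (f @^-1: J')) = zd (drestr Q J').
  by apply: zd_iso; apply: (drestr_iso fK gK) => // x; rewrite inE.
by rewrite -preimsetC !isoJ.
Qed.

Lemma zd_deltaE (T : finType) (P : dposet T) :
  zd_delta (zd P) = decompositions P.
Proof. by rewrite /zd_delta linU; apply/decompositions_iso/drepr_iso. Qed.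

Lemma zd_counitE (T : finType) (P : dposet T) :
  zd_counit (zd P) = (#|T| == 0)%:R.
Proof.
rewrite /zd_counit linU; congr (nat_of_bool _)%:R.
apply/eqP/eqP => [/(congr1 dsize)|T0]; first by rewrite !dsize_cls card_void.
apply/dclsP/disoP; have TF (x : T) : False by have := card0_eq T0 x.
exists (fun x => match TF x with end), (fun v => of_void T v).
by split=> x //; case: (TF x).
Qed.

Lemma zd_pairE (T U : finType) (P : dposet T) (Q : dposet U) :
  zd_pair (zd P) (zd Q) = (npictures P Q)%:Z.
Proof.
by rewrite /zd_pair !linU (npictures_iso (drepr_iso P) (drepr_iso Q)).
Qed.

(* Main.v *)
Require Import Defs.
From HB Require Import structures.
From mathcomp Require Import all_boot all_order all_algebra.
From mathcomp Require Import finmap.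
From mathcomp.multinomials Require Import monalg.

(** Every structure map on the free module on isomorphism classes is determined
    by its values on double posets, so each axiom is an identity between two
    sums of (tensors of) double posets, and each is proved by matching the two
    index sets and exhibiting an isomorphism between the matched terms.

    Coassociativity: restricting twice is restricting once (drestr_drestr), so
    both iterated coproducts of P are sums over chains B <= A of lower ideals of
    P of the tensor P|B, P|(A minus B), P|(complement of A); lower_chain and
    lower_idealU identify the two index sets with these chains.

    Compatibility of product and coproduct: the first order of a composition PQ
    relates no element of P to an element of Q, so a lower ideal of PQ is
    exactly a pair of lower ideals (lower_ideal_dcomp), and restricting PQ to it
    gives the composition of the restrictions (drestr_dcomp).

    Antipode: the bialgebra is graded by the number of elements and its degree
    0 part is spanned by the unit, so Takeuchi's formula applies: with u the
    unit of the convolution product and J = u - id, the convolution powers of J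
    vanish on degrees smaller than the exponent, hence the geometric series of
    J is locally finite and inverts u - J = id (conv_takeuchil,
    conv_takeuchir).  This part is carried out for any connected graded
    bialgebra structure on a free module with a graded basis.

    Self-duality: for a picture f from EF to G, the image I of E is a lower
    ideal of G, because f^-1 sends the first order of G into the second order
    of EF, where no element of F lies below an element of E.  Then f restricts
    to pictures from E to G|I and from F to the restriction of G to the
    complement of I; conversely any two such pictures glue, since in EF all of
    E is below all of F for the second order (npictures_dcomp). *)

Set Implicit Arguments.
Unset Strict Implicit.
Unset Printing Implicit Defensive.

Import GRing.Theory.
Local Open Scope ring_scope.

(** * Additive maps on free modules *)

Section AdditiveMaps.
Context {K : choiceType} {M : zmodType}.
Implicit Types (f g : {malg int[K]} -> M) (a : {malg int[K]}).

Lemma lin_zmod_morphism (h : K -> M) : zmod_morphism (lin h).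
Proof.
have h0 : lin h 0 = 0 by apply: (addrI (lin h 0)); rewrite -linD !addr0.
move=> a b; rewrite linD; congr (_ + _).
by apply: (addrI (lin h b)); rewrite -linD !subrr h0.
Qed.

HB.instance Definition _ (h : K -> M) :=
  GRing.isZmodMorphism.Build {malg int[K]} M (lin h) (lin_zmod_morphism h).

Lemma morph_linE f : {morph f : a b / a + b} -> f =1 lin (fun k => f << k >>).
Proof. by move=> fD; apply: lin_unique. Qed.

Lemma eq_on_basis f g :
    {morph f : a b / a + b} -> {morph g : a b / a + b} ->
  (forall k, f << k >> = g << k >>) -> f =1 g.
Proof.
move=> fD gD fg a; rewrite (morph_linE fD) (morph_linE gD).
exact: eq_lin.
Qed.

Lemma morph_add0 f : {morph f : a b / a + b} -> f 0 = 0.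
Proof. by move=> fD; rewrite (morph_linE fD) raddf0. Qed.

Lemma morph_addN f : {morph f : a b / a + b} -> {morph f : a / - a}.
Proof. by move=> fD a; rewrite !(morph_linE fD) raddfN. Qed.

Lemma morph_addMz f z : {morph f : a b / a + b} -> {morph f : a / a *~ z}.
Proof. by move=> fD a; rewrite !(morph_linE fD) raddfMz. Qed.

Lemma morph_sum f (I : Type) (r : seq I) (P : pred I) F :
    {morph f : a b / a + b} ->
  f (\sum_(i <- r | P i) F i) = \sum_(i <- r | P i) f (F i).
Proof. by move=> fD; rewrite (big_morph f fD (morph_add0 fD)). Qed.

Lemma lin_sum (I : Type) (r : seq I) (P : pred I) (h : I -> K -> M) a :
  lin (fun k => \sum_(i <- r | P i) h i k) a = \sum_(i <- r | P i) lin (h i) a.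
Proof.
rewrite /lin exchange_big; apply: eq_bigr => k _.
by rewrite /= mulrz_suml.
Qed.

Lemma lin_subf (h h' : K -> M) a :
  lin (fun k => h k - h' k) a = lin h a - lin h' a.
Proof. by rewrite /lin -sumrB; apply: eq_bigr => k _; rewrite mulrzBl. Qed.

End AdditiveMaps.

Lemma lin_id (K : choiceType) (a : {malg int[K]}) : lin (fun k => << k >>) a = a.
Proof. exact/esym/(@morph_linE _ _ id). Qed.

Section BasisExtension.
Variable K : choiceType.
Local Notation A := {malg int[K]}.
Variables (mul : A -> A -> A).
Hypothesis mulD : biadditive mul.

Lemma algebra_on_basis (one : A) :
    (forall x y z, mul << x >> (mul << y >> << z >>)
                   = mul (mul << x >> << y >>) << z >>) ->
    (forall x, mul one << x >> = << x >>) ->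
    (forall x, mul << x >> one = << x >>) ->
  is_algebra mul one.
Proof.
have [mulDl mulDr] := mulD.
move=> mulA mul1 mulr1; split=> // [a b c | |].
- apply: (eq_on_basis (f := fun a => mul a (mul b c))
    (g := fun a => mul (mul a b) c)) => [x y|x y|k]; rewrite ?mulDl //.
  apply: (eq_on_basis (f := fun b => mul << k >> (mul b c))
    (g := fun b => mul (mul << k >> b) c)) => [x y|x y|l].
  + by rewrite mulDl mulDr.
  + by rewrite mulDr mulDl.
  apply: (eq_on_basis (f := fun c => mul << k >> (mul << l >> c))
    (g := fun c => mul (mul << k >> << l >>) c)) => [x y|x y|m]; by rewrite ?mulDr.
- exact: (eq_on_basis (g := id) (mulDr one) (fun _ _ => erefl) mul1).
- exact: (eq_on_basis (g := id) (mulDl one) (fun _ _ => erefl) mulr1).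
Qed.

Lemma tmulD : biadditive (tmul mul).
Proof.
split=> [y|x]; first exact: tliftD.
by move=> y y'; rewrite /tmul -lin_sumf; apply: eq_lin => k; exact: tliftD.
Qed.

Lemma morphism_on_basis (M : zmodType) (f : A -> M)
    (mul' : M -> M -> M) :
    biadditive mul' -> {morph f : a b / a + b} ->
    (forall x y, f (mul << x >> << y >>) = mul' (f << x >>) (f << y >>)) ->
  forall a b, f (mul a b) = mul' (f a) (f b).
Proof.
have [mulDl mulDr] := mulD.
move=> [mulDl' mulDr'] fD fM a b.
apply: (eq_on_basis (f := fun a => f (mul a b))
  (g := fun a => mul' (f a) (f b))) => [x y|x y|k].
- by rewrite mulDl fD.
- by rewrite fD mulDl'.
apply: (eq_on_basis (f := fun b => f (mul << k >> b))
  (g := fun b => mul' (f << k >>) (f b))) => [x y|x y|l //].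
- by rewrite mulDr fD.
- by rewrite fD mulDr'.
Qed.

Lemma coassoc_on_basis (delta : A -> {malg int[(K * K)%type]}) :
    {morph delta : a b / a + b} ->
    (forall x, tlift (fun b c => delta b \ot c) (delta << x >>)
       = tassoc (tlift (fun b c => b \ot delta c) (delta << x >>))) ->
  forall a, tlift (fun b c => delta b \ot c) (delta a)
            = tassoc (tlift (fun b c => b \ot delta c) (delta a)).
Proof.
have assocD : {morph @tassoc K : a b / a + b} by exact: tliftD.
move=> deltaD; apply: (eq_on_basis (f := fun a => tlift _ (delta a))
  (g := fun a => tassoc (tlift _ (delta a)))) => a b.
  by rewrite deltaD tliftD.
by rewrite deltaD tliftD assocD.
Qed.

Lemma tlift_on_basis (delta : A -> {malg int[(K * K)%type]}) (h : A -> A -> A) :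
    {morph delta : a b / a + b} ->
    (forall x, tlift h (delta << x >>) = << x >>) ->
  forall a, tlift h (delta a) = a.
Proof.
move=> deltaD; apply: (eq_on_basis (f := fun a => tlift h (delta a)) (g := id)) => //.
by move=> a b; rewrite deltaD tliftD.
Qed.

Lemma tassocU (a b c : K) :
  tassoc (<< a >> \ot (<< b >> \ot << c >>)) = << a >> \ot << b >> \ot << c >>.
Proof. by rewrite !tensU /tassoc !tliftU !tensU. Qed.

End BasisExtension.

(** * Supports and gradings *)

Section Supports.
Context {K : choiceType}.
Implicit Types (D : K -> Prop) (a b : {malg int[K]}).

Definition supported D a : Prop := forall k, k \in msupp a -> D k.

Lemma supported0 D : supported D 0.
Proof. by move=> k; rewrite msupp0 inE. Qed.

Lemma supportedB D a b : supported D a -> supported D b -> supported D (a - b).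
Proof.
move=> aD bD k /(fsubsetP (msuppB_le _ _)); rewrite inE.
by case/orP=> [/aD | /bD].
Qed.

Lemma supportedN D a : supported D a -> supported D (- a).
Proof. by move=> aD; rewrite -sub0r; apply: supportedB => //; apply: supported0. Qed.

Lemma supportedD D a b : supported D a -> supported D b -> supported D (a + b).
Proof.
by move=> aD bD; rewrite -(opprK b); apply: supportedB => //; apply: supportedN.
Qed.

Lemma supported_sum D (I : Type) (r : seq I) (P : pred I) (F : I -> {malg int[K]}) :
  (forall i, P i -> supported D (F i)) -> supported D (\sum_(i <- r | P i) F i).
Proof.
move=> FD; apply: big_ind => [||i /FD //]; [exact: supported0|].
by move=> a b; apply: supportedD.
Qed.

Lemma supportedMz D a z : supported D a -> supported D (a *~ z).
Proof.
have nat_case n : supported D a -> supported D (a *+ n).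
  move=> aD; elim: n => [|n IHn]; first by rewrite mulr0n; apply: supported0.
  by rewrite mulrS; apply: supportedD.
case: z => n aD; first by rewrite -pmulrn; apply: nat_case.
by rewrite NegzE mulrNz -pmulrn; apply: supportedN; apply: nat_case.
Qed.

Lemma supportedU D k : D k -> supported D << k >>.
Proof. by move=> Dk l /(fsubsetP msuppU_le); rewrite inE => /eqP->. Qed.

End Supports.

Section SupportedMaps.
Context {K : choiceType}.

Lemma supported_lin (L : choiceType) (D : K -> Prop) (D' : L -> Prop)
    (h : K -> {malg int[L]}) a :
    supported D a -> (forall k, D k -> supported D' (h k)) ->
  supported D' (lin h a).
Proof.
move=> aD hD; rewrite /lin big_seq; apply: supported_sum => k /aD Dk.
by apply: supportedMz; apply: hD.
Qed.

Lemma eq_lin_supported (M : zmodType) (D : K -> Prop) (h h' : K -> M) a :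
  supported D a -> (forall k, D k -> h k = h' k) -> lin h a = lin h' a.
Proof.
by move=> aD hh'; rewrite /lin; apply: eq_big_seq => k /aD Dk; rewrite hh'.
Qed.

Lemma eq_on_support (M : zmodType) (D : K -> Prop)
    (f g : {malg int[K]} -> M) a :
    {morph f : a b / a + b} -> {morph g : a b / a + b} -> supported D a ->
  (forall k, D k -> f << k >> = g << k >>) -> f a = g a.
Proof.
move=> fD gD aD fg; rewrite (morph_linE fD) (morph_linE gD).
exact: eq_lin_supported aD fg.
Qed.

End SupportedMaps.

Section SizeGrading.
Context {K : choiceType} (sz : K -> nat).
Local Notation gr n := (supported (fun k => sz k = n)).

Lemma supported_grading : is_grading (fun n a => gr n a).
Proof.
split=> [n|n a b|a|n f fn f0 i].
- exact: supported0.
- exact: supportedB.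
- pose N := (\max_(k <- msupp a) sz k).+1.
  exists N, (fun i => \sum_(k <- msupp a | sz k == i) << k >> *~ a@_k); split.
    by move=> i; apply: supported_sum => k /eqP ki; apply: supportedMz; apply: supportedU.
  rewrite (exchange_big_dep xpredT) //=.
  rewrite -[LHS]lin_id /lin big_seq [RHS]big_seq; apply: eq_bigr => k ka.
  have kN : (sz k < N)%N by rewrite ltnS; apply: leq_bigmax_seq.
  by rewrite (big_pred1 (Ordinal kN)) // => i; rewrite -val_eqE /= eq_sym.
apply/malgP => k; rewrite mcoeff0.
have [ki|ki] := eqVneq (sz k) i; last first.
  by apply: mcoeff_outdom; apply: contra ki => /fn ->.
have := congr1 (mcoeff k) f0; rewrite mcoeff0 raddf_sum (bigD1 i) //= big1 ?addr0 //.
move=> j ji; apply: mcoeff_outdom; apply: contra ji => /fn kj.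
by rewrite -val_eqE /= -kj ki.
Qed.

(** Reading off the support of an element writes it as a sum of homogeneous
    tensors, which is what tgr asks for. *)
Lemma supported_tgr n (x : {malg int[(K * K)%type]}) :
  supported (fun p => sz p.1 + sz p.2 = n)%N x -> tgr (fun n a => gr n a) n x.
Proof.
move=> xn; pose p (k : 'I_(size (msupp x))) := tnth (in_tuple (msupp x)) k.
exists (size (msupp x)), (fun k => sz (p k).1),
  (fun k => << (p k).1 >> *~ x@_(p k)), (fun k => << (p k).2 >>); split.
  move=> k; have <- := xn (p k) (mem_tnth _ _); rewrite leq_addr addKn.
  by split=> //; [apply: supportedMz|]; apply: supportedU.
rewrite -[LHS]lin_id /lin big_tnth; apply: eq_bigr => k _.
rewrite (morph_addMz _ (tensD.1 _)) tensU -/(p k).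
by case: (p k).
Qed.

End SizeGrading.

(** * The antipode of a connected graded bialgebra *)

Section Takeuchi.
Variables (K : choiceType) (sz : K -> nat).
Local Notation A := {malg int[K]}.
Variables (mul : A -> A -> A) (one : A).
Variables (delta : A -> {malg int[(K * K)%type]}) (eps : A -> int).
Hypothesis bialgA : is_bialgebra mul one delta eps.

Let algA := bialg_algebra bialgA.
Let coalgA := bialg_coalgebra bialgA.
Let mulDl := (alg_mul_bilinear algA).1.
Let mulDr := (alg_mul_bilinear algA).2.
Let deltaD := coalg_delta_linear coalgA.
Let epsD := coalg_eps_linear coalgA.

Definition conv (f g : A -> A) (a : A) : A :=
  tlift (fun b c => mul (f b) (g c)) (delta a).

Definition conv_unit (a : A) : A := one *~ eps a.

Lemma conv_unitD : {morph conv_unit : a b / a + b}.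
Proof. by move=> a b; rewrite /conv_unit epsD mulrzDr. Qed.

Lemma convD f g : {morph conv f g : a b / a + b}.
Proof. by move=> a b; rewrite /conv deltaD tliftD. Qed.

Lemma eq_conv f f' g g' : f =1 f' -> g =1 g' -> conv f g =1 conv f' g'.
Proof. by move=> ff' gg' a; apply: eq_lin => -[k l] /=; rewrite ff' gg'. Qed.

Lemma conv_unitr f : {morph f : a b / a + b} -> conv f conv_unit =1 f.
Proof.
move=> fD a; rewrite -{2}(coalg_counitr coalgA a) /conv.
apply: (@eq_on_basis _ _ (tlift _) (fun x => f (tlift _ x))) => [x y | x y | [k l]].
- exact: tliftD.
- by rewrite tliftD fD.
rewrite !tliftU (morph_addMz _ fD) (morph_addMz _ (mulDr _)).
by rewrite (alg_mulr1 algA).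
Qed.

Lemma conv_unitl f : {morph f : a b / a + b} -> conv conv_unit f =1 f.
Proof.
move=> fD a; rewrite -{2}(coalg_counitl coalgA a) /conv.
apply: (@eq_on_basis _ _ (tlift _) (fun x => f (tlift _ x))) => [x y | x y | [k l]].
- exact: tliftD.
- by rewrite tliftD fD.
rewrite !tliftU (morph_addMz _ fD) (morph_addMz _ (mulDl _)).
by rewrite (alg_mul1 algA).
Qed.

(** Both sides are images of the two iterated coproducts of a under the map
    b, c, d |-> (f b)(g c)(h d) on the triple tensor power, so this is
    coassociativity of delta together with associativity of mul. *)
Lemma convA f g h :
    {morph f : a b / a + b} -> {morph g : a b / a + b} ->
    {morph h : a b / a + b} ->
  conv (conv f g) h =1 conv f (conv g h).
Proof.
move=> fD gD hD a.
(* The map (b tensor b') tensor c |-> (f b)(g b')(h c). *)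
pose mul3 (x : {malg int[(K * K)%type]}) (c : A) :=
  mul (tlift (fun b b' => mul (f b) (g b')) x) (h c).
have mul3D : biadditive mul3.
  by split=> [c|x] y z; rewrite /mul3 ?tliftD ?hD ?mulDl ?mulDr.
have fgD : biadditive (fun b b' => mul (f b) (g b')).
  by split=> [c|x] y z; rewrite ?fD ?gD ?mulDl ?mulDr.
transitivity (tlift mul3 (tlift (fun b c => delta b \ot c) (delta a))).
  apply: (@eq_on_basis _ _ (tlift _) (fun x => tlift mul3 (tlift _ x)))
    => [x y | x y | [k l]]; rewrite ?tliftD //.
  by rewrite !tliftU tliftE.
rewrite (coalg_coassoc coalgA).
apply: (@eq_on_basis _ _ (fun x => tlift mul3 (tassoc (tlift _ x))) (tlift _))
    => [x y | x y | [k l]]; rewrite /tassoc ?tliftD // !tliftU /conv.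
apply: (@eq_on_basis _ _ (fun x => tlift mul3 (tlift _ (<< k >> \ot x)))
  (fun x => mul (f << k >>) (tlift _ x))) => [x y | x y | [b c]].
- by rewrite (tensD.2 _) !tliftD.
- by rewrite tliftD mulDr.
rewrite tensU !tliftU tliftE // /mul3 tensU tliftU.
by rewrite (alg_mulA algA).
Qed.

Local Notation gr n := (supported (fun k => sz k = n)).
Local Notation gr2 n := (supported (fun p => sz p.1 + sz p.2 = n)%N).

Hypothesis gr_mul : forall i j a b, gr i a -> gr j b -> gr (i + j)%N (mul a b).
Hypothesis gr_one : gr 0%N one.
Hypothesis gr_delta : forall n a, gr n a -> gr2 n (delta a).
Hypothesis gr_eps : forall n a, gr n a -> n <> 0%N -> eps a = 0.
Hypothesis connected : forall a, gr 0%N a -> a = one *~ eps a.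

Lemma conv_gr f g :
    (forall n a, gr n a -> gr n (f a)) -> (forall n a, gr n a -> gr n (g a)) ->
  forall n a, gr n a -> gr n (conv f g a).
Proof.
move=> fgr ggr n a /gr_delta an; apply: (supported_lin an) => -[k l] /= <-.
by apply: gr_mul; [apply: fgr | apply: ggr]; apply: supportedU.
Qed.

(** The map J = u - id, where u is the unit for convolution; the identity is
    u - J, so an antipode is the geometric series of J. *)
Definition reduced (a : A) : A := conv_unit a - a.

Lemma reducedD : {morph reduced : a b / a + b}.
Proof. by move=> a b; rewrite /reduced conv_unitD opprD addrACA. Qed.

Lemma conv_unit_gr n a : gr n a -> gr n (conv_unit a).
Proof.
move=> an; have [n0 | /eqP n0] := eqVneq n 0%N.
  by apply: supportedMz; rewrite n0.
by rewrite /conv_unit (gr_eps an n0) mulr0z; apply: supported0.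
Qed.

Definition reduced_pow n : A -> A := iter n (conv reduced) conv_unit.

Lemma reduced_powD n : {morph reduced_pow n : a b / a + b}.
Proof. by case: n => [|n]; [exact: conv_unitD | exact: convD]. Qed.

Lemma reduced_pow_gr n : forall m a, gr m a -> gr m (reduced_pow n a).
Proof.
elim: n => [|n IHn]; first exact: conv_unit_gr.
apply: conv_gr => // m a am.
by apply: supportedB => //; apply: conv_unit_gr.
Qed.

(** J kills degree 0 because the bialgebra is connected, so in each tensor of
    the coproduct either the left factor is killed by J or the right factor has
    smaller degree, where the lower power of J vanishes. *)
Lemma reduced_pow_eq0 n m a : (m < n)%N -> gr m a -> reduced_pow n a = 0.
Proof.
elim: n m a => // n IHn m a; rewrite ltnS => le_mn am.
rewrite /reduced_pow iterS -/(reduced_pow n) /conv.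
transitivity (lin (fun=> 0 : A) (delta a)); last first.
  by rewrite /lin big1 // => p _; rewrite mul0rz.
(* The two tensor factors have degrees adding up to m <= n. *)
apply: (eq_lin_supported (gr_delta am)) => -[k l] /= kl.
have [k0 | k_gt0] := posnP (sz k).
  rewrite /reduced /conv_unit -connected ?subrr ?(morph_add0 (mulDl _)) //.
  exact: supportedU.
rewrite (IHn (sz l)) ?(morph_add0 (mulDr _)) //; last exact: supportedU.
by rewrite (leq_trans _ le_mn) // -kl -add1n leq_add2r.
Qed.

(** The powers of J are built by multiplying on the left; this gives the same
    powers by multiplying on the right, which the left antipode law needs. *)
Lemma reduced_powSr n : conv (reduced_pow n) reduced =1 reduced_pow n.+1.
Proof.
elim: n => [|n IHn] a.
  by rewrite /reduced_pow /= (conv_unitl reducedD) (conv_unitr reducedD).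
rewrite (convA reducedD (reduced_powD n) reducedD).
exact: eq_conv.
Qed.

Definition takeuchi (a : A) : A :=
  lin (fun k => \sum_(n < (sz k).+1) reduced_pow n << k >>) a.

(** On a basis vector the series stops at its degree.  Allowing any larger
    bound N makes one finite sum serve for all the tensor factors of a
    coproduct at once. *)
Lemma takeuchi_trunc N a :
    supported (fun k => sz k <= N)%N a ->
  takeuchi a = \sum_(n < N.+1) reduced_pow n a.
Proof.
move=> aN; apply: (eq_on_support (g := fun a => \sum_(n < N.+1) _ ) _ _ aN).
- exact: linD.
- by move=> x y /=; rewrite -big_split; apply: eq_bigr => n _; apply: reduced_powD.
move=> k kN; rewrite /takeuchi linU (big_ord_widen N.+1 (fun n => reduced_pow n _)) //.
rewrite [RHS](bigID (fun n : 'I__ => n < (sz k).+1)%N) /= [X in _ + X]big1 ?addr0 //.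
move=> n; rewrite -leqNgt => lt_kn.
by apply: (reduced_pow_eq0 lt_kn); apply: supportedU.
Qed.

(** The telescoping behind (sum of J^i)(u - J) = u - J^(n+1), whose last term
    vanishes in degree n. *)
Lemma takeuchi_telescope n (a : A) :
    gr n a ->
  \sum_(i < n.+1) (reduced_pow i a - reduced_pow i.+1 a) = conv_unit a.
Proof.
move=> an; rewrite -[LHS]opprK -sumrN; under eq_bigr do rewrite opprB.
rewrite -(big_mkord xpredT (fun i => reduced_pow i.+1 a - reduced_pow i a)).
by rewrite telescope_sumr // opprB (reduced_pow_eq0 (ltnSn n) an) subr0.
Qed.

Lemma conv_takeuchil : conv takeuchi id =1 conv_unit.
Proof.
apply: eq_on_basis => [||k]; [exact: convD | exact: conv_unitD |].
have kn : gr (sz k) << k >> by apply: supportedU.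
rewrite -(takeuchi_telescope kn).
transitivity (\sum_(i < (sz k).+1)
    tlift (fun b c => mul (reduced_pow i b) (conv_unit c - reduced c)) (delta << k >>)).
  rewrite -lin_sum; apply: (eq_lin_supported (gr_delta kn)) => -[b c] /= bc.
  rewrite (takeuchi_trunc (N := sz k)); last by apply: supportedU; rewrite -bc leq_addr.
  rewrite (big_morph _ (mulDl _) (morph_add0 (mulDl _))).
  by apply: eq_bigr => i _; rewrite /reduced opprB addrC subrK.
apply: eq_bigr => i _.
rewrite -{1}(conv_unitr (reduced_powD i)) -reduced_powSr /conv -lin_subf.
apply: eq_lin => -[b c] /=.
by rewrite mulDr (morph_addN (mulDr _)).
Qed.

Lemma conv_takeuchir : conv id takeuchi =1 conv_unit.
Proof.
apply: eq_on_basis => [||k]; [exact: convD | exact: conv_unitD |].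
have kn : gr (sz k) << k >> by apply: supportedU.
rewrite -(takeuchi_telescope kn).
transitivity (\sum_(i < (sz k).+1)
    tlift (fun b c => mul (conv_unit b - reduced b) (reduced_pow i c)) (delta << k >>)).
  rewrite -lin_sum; apply: (eq_lin_supported (gr_delta kn)) => -[b c] /= bc.
  rewrite (takeuchi_trunc (N := sz k)); last by apply: supportedU; rewrite -bc leq_addl.
  rewrite (big_morph _ (mulDr _) (morph_add0 (mulDr _))).
  by apply: eq_bigr => i _; rewrite /reduced opprB addrC subrK.
apply: eq_bigr => i _.
rewrite -{1}(conv_unitl (reduced_powD i)) /reduced_pow iterS /conv -lin_subf.
apply: eq_lin => -[b c] /=.
by rewrite (mulDl _) (morph_addN (mulDl _)).
Qed.

Lemma takeuchi_antipode :
  exists S : A -> A, is_antipode mul one delta eps S /\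
    (forall n a, gr n a -> gr n (S a)).
Proof.
exists takeuchi; split; first split.
- exact: linD.
- exact: conv_takeuchil.
- exact: conv_takeuchir.
move=> n a an; apply: (supported_lin an) => k kn.
by apply: supported_sum => i _; apply: reduced_pow_gr; apply: supportedU.
Qed.

End Takeuchi.

(** * Isomorphisms of double posets *)

Lemma diso_bij (T U : finType) (P : dposet T) (Q : dposet U) (f : T -> U) :
    injective f -> (forall y, exists x, f x = y) ->
    (forall x y, lt1 P x y = lt1 Q (f x) (f y)) ->
    (forall x y, lt2 P x y = lt2 Q (f x) (f y)) ->
  diso P Q.
Proof.
move=> f_inj f_surj f1 f2.
have fP y : exists x, f x == y by have [x <-] := f_surj y; exists x.
have fK y : f (xchoose (fP y)) = y by apply/eqP/(xchooseP (fP y)).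
apply/disoP; exists f, (fun y => xchoose (fP y)); split=> // x.
exact/f_inj/fK.
Qed.

Lemma drestrT (T : finType) (P : dposet T) : diso (drestr P setT) P.
Proof.
apply: (@diso_bij _ _ _ _ val) => [|x|x y|x y]; rewrite ?lt1_mk ?lt2_mk //.
  exact: val_inj.
by exists (Sub x (in_setT x)).
Qed.

(** Restrictions live on nested subtypes; this brings iterated restrictions
    back to subsets of the original set, where they can be compared. *)
Lemma drestr_drestr (T : finType) (P : dposet T) (I : {set T})
    (J : {set {x | x \in I}}) :
  diso (drestr (drestr P I) J) (drestr P (val @: J)).
Proof.
have valJ (u : {x | x \in J}) : val (val u) \in val @: J by apply/imset_f/valP.
apply: (@diso_bij _ _ _ _ (fun u => Sub (val (val u)) (valJ u)))
    => [u v /(congr1 val)|y|x y|x y].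
- by move=> /= /val_inj/val_inj.
- have /imsetP[x xJ yx] := valP y.
  by exists (Sub x xJ); apply: val_inj.
- by rewrite !lt1_mk.
- by rewrite !lt2_mk.
Qed.

Definition sum_set (T U : finType) (I : {set T}) (J : {set U}) : {set T + U} :=
  [set z | match z with inl x => x \in I | inr y => y \in J end].

Lemma in_sum_set (T U : finType) (I : {set T}) (J : {set U}) z :
  z \in sum_set I J = match z with inl x => x \in I | inr y => y \in J end.
Proof. by rewrite inE. Qed.

Lemma setC_sum_set (T U : finType) (I : {set T}) (J : {set U}) :
  ~: sum_set I J = sum_set (~: I) (~: J).
Proof. by apply/setP => -[x|x]; rewrite in_setC !in_sum_set in_setC. Qed.

Lemma drestr_dcomp (T U : finType) (P : dposet T) (Q : dposet U)
    (I : {set T}) (J : {set U}) :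
  diso (dcomp (drestr P I) (drestr Q J)) (drestr (dcomp P Q) (sum_set I J)).
Proof.
pose f0 (z : {x | x \in I} + {y | y \in J}) : T + U :=
  match z with inl x => inl (val x) | inr y => inr (val y) end.
have f0P z : f0 z \in sum_set I J by case: z => z; rewrite in_sum_set /=; apply: valP.
apply: (@diso_bij _ _ _ _ (fun z => Sub (f0 z) (f0P z))).
- by move=> [u|u] [v|v] /(congr1 val) //= [] /val_inj->.
- case=> -[x|y] xy; have := etrans (esym (in_sum_set I J _)) xy => xy'.
    by exists (inl (Sub x xy')); apply: val_inj.
  by exists (inr (Sub y xy')); apply: val_inj.
- by move=> [u|u] [v|v]; rewrite !lt1_mk /= ?lt1_mk.
- by move=> [u|u] [v|v]; rewrite !lt2_mk /= ?lt2_mk.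
Qed.

Lemma dcompA (T U V : finType) (P : dposet T) (Q : dposet U) (R : dposet V) :
  diso (dcomp P (dcomp Q R)) (dcomp (dcomp P Q) R).
Proof.
pose f (z : T + (U + V)) : T + U + V :=
  match z with
  | inl x => inl (inl x) | inr (inl y) => inl (inr y) | inr (inr z) => inr z
  end.
apply: (@diso_bij _ _ _ _ f).
- by move=> [?|[?|?]] [?|[?|?]] //= [->].
- by move=> [[x|x]|x]; [exists (inl x) | exists (inr (inl x)) | exists (inr (inr x))].
- by move=> [?|[?|?]] [?|[?|?]]; rewrite !lt1_mk /= ?lt1_mk.
- by move=> [?|[?|?]] [?|[?|?]]; rewrite !lt2_mk /= ?lt2_mk.
Qed.

Lemma dcomp0P (T : finType) (P : dposet T) : diso P (dcomp dempty P).
Proof.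
apply: (@diso_bij _ _ _ _ inr) => [x y []|[[]|x]|x y|x y] //.
- by exists x.
- by rewrite lt1_mk.
- by rewrite lt2_mk.
Qed.

Lemma dcompP0 (T : finType) (P : dposet T) : diso P (dcomp P dempty).
Proof.
apply: (@diso_bij _ _ _ _ inl) => [x y []|[x|[]]|x y|x y] //.
- by exists x.
- by rewrite lt1_mk.
- by rewrite lt2_mk.
Qed.

(** * Lower ideals *)

Section LowerIdeals.
Variables (T : finType) (P : dposet T).
Implicit Types I A B C : {set T}.

(** A is a lower ideal of the restriction of P to I, phrased without the
    subtype of elements of I. *)
Definition lower_in I A : bool :=
  [forall x in I, forall y in A, lt1 P x y ==> (x \in A)].

Lemma lower_inP I A :
  reflect (forall x y, x \in I -> y \in A -> lt1 P x y -> x \in A) (lower_in I A).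
Proof.
apply: (iffP forall_inP) => [low x y xI yA | low x xI].
  by move: (low x xI) => /forall_inP/(_ y yA)/implyP.
by apply/forall_inP => y yA; apply/implyP; apply: low.
Qed.

Lemma lower_idealP I :
  reflect (forall x y, y \in I -> lt1 P x y -> x \in I) (lower_ideal P I).
Proof.
apply: (iffP forallP) => [low x y yI xy | low x].
  by move: (low x) => /forallP/(_ y); rewrite yI xy.
by apply/forallP => y; apply/implyP => /andP[]; apply: low.
Qed.

Lemma lower_ideal_drestr I (J : {set {x | x \in I}}) :
  lower_ideal (drestr P I) J = lower_in I (val @: J).
Proof.
apply/forallP/lower_inP => [low x y xI /imsetP[v vJ ->] xv | low u].
  have /forallP/(_ v) := low (Sub x xI).
  by rewrite vJ lt1_mk /= xv; apply: imset_f.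
apply/forallP => v; apply/implyP; rewrite lt1_mk => /andP[vJ uv].
by rewrite -(mem_imset _ _ val_inj); apply: low uv; [apply: valP | apply: imset_f].
Qed.

(** Index set of the left iterated coproduct: a lower ideal B of a lower ideal
    A of P is just a lower ideal of P contained in A. *)
Lemma lower_chain A B :
  lower_ideal P A && ((B \subset A) && lower_in A B)
  = lower_ideal P B && ((B \subset A) && lower_ideal P A).
Proof.
have [BA|_] /= := boolP (B \subset A); last by rewrite !andbF.
apply/andP/andP => -[].
  move=> lowA /lower_inP lowB; split=> //; apply/lower_idealP => x y yB xy.
  apply: (lowB x y) => //; move/lower_idealP: lowA => lowA.
  by apply: (lowA x y) => //; apply: (subsetP BA).
move=> /lower_idealP lowB lowA; split=> //.
by apply/lower_inP => x y _; apply: lowB.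
Qed.

(** Index set of the right iterated coproduct: once the lower ideal B is cut
    off, lower ideals of what remains correspond to lower ideals of P
    containing B. *)
Lemma lower_idealU B C :
  lower_ideal P B -> lower_ideal P (B :|: C) = lower_in (~: B) (C :\: B).
Proof.
move=> /lower_idealP lowB; apply/lower_idealP/lower_inP => low x y.
  rewrite !inE => xB /andP[yB yC] xy; rewrite xB /=.
  by have := low x y; rewrite !inE (negbTE xB) yC orbT; apply.
move=> yBC xy; rewrite !inE.
have [//|xB] := boolP (x \in B).
have yB : y \notin B by apply: contra xB => yB; apply: lowB yB xy.
have := low x y; rewrite !inE xB yB /= => -> //.
by move: yBC; rewrite inE (negbTE yB).
Qed.

End LowerIdeals.

(** The first order of a composition has no relation between the two factors,
    so the two parts of a lower ideal can be chosen independently. *)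
Lemma lower_ideal_dcomp (T U : finType) (P : dposet T) (Q : dposet U)
    (I : {set T}) (J : {set U}) :
  lower_ideal (dcomp P Q) (sum_set I J) = lower_ideal P I && lower_ideal Q J.
Proof.
apply/lower_idealP/andP => [low | [/lower_idealP lowI /lower_idealP lowJ]].
  split; apply/lower_idealP => x y yI xy.
    by have := low (inl x) (inl y); rewrite !in_sum_set lt1_mk; apply.
  by have := low (inr x) (inr y); rewrite !in_sum_set lt1_mk; apply.
by move=> [x|x] [y|y]; rewrite !in_sum_set lt1_mk //=; [apply: lowI | apply: lowJ].
Qed.

Lemma dsize_drestr (T : finType) (P : dposet T) (I : {set T}) :
  dsize (dcls (drestr P I)) = #|I|.
Proof. by rewrite dsize_cls card_sig; apply: eq_card => x; rewrite inE. Qed.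

(** * Pictures from a composition *)

Section Pictures.
Variables (T U V : finType) (P : dposet T) (Q : dposet U) (R : dposet V).

Section Glue.
Variable I : {set V}.
Local Notation VI := {x | x \in I}.
Local Notation VS := {x | x \in ~: I}.

Definition glue (gh : {ffun T -> VI} * {ffun U -> VS}) : {ffun T + U -> V} :=
  [ffun z => match z with inl x => val (gh.1 x) | inr y => val (gh.2 y) end].

Lemma glue_inj : injective glue.
Proof.
move=> [g h] [g' h'] /ffunP eq_gh; congr (_, _); apply/ffunP => x; apply: val_inj.
  by have := eq_gh (inl x); rewrite !ffunE.
by have := eq_gh (inr x); rewrite !ffunE.
Qed.

(** The only inequality that mixes both parts is between x in I and y outside
    I: if x is below y for the first order of R then the inverse sends them to
    the left and the right factor, which are in the required second order; y
    below x is excluded because I is a lower ideal. *)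
Lemma glue_picture g h :
    picture P (drestr R I) g -> picture Q (drestr R (~: I)) h ->
    lower_ideal R I ->
  picture (dcomp P Q) R (glue (g, h)) /\ [set glue (g, h) (inl x) | x : T] = I.
Proof.
move=> /pictureP[g' [gK g'K g1 g2]] /pictureP[h' [hK h'K h1 h2]] /lower_idealP lowI.
have inC x : x \notin I -> x \in ~: I by rewrite inE.
(* The inverse of the glued map, defined by cases on membership in I. *)
pose k (x : V) : T + U :=
  match boolP (x \in I) with
  | AltTrue xI => inl (g' (Sub x xI))
  | AltFalse xI => inr (h' (Sub x (inC x xI)))
  end.
have kI x (xI : x \in I) : k x = inl (g' (Sub x xI)).
  rewrite /k; case: {-}_ / boolP => [xI'|xI']; last by case/negP: (xI').
  by congr (inl (g' _)); apply: val_inj.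
have kC x (xC : x \in ~: I) : k x = inr (h' (Sub x xC)).
  rewrite /k; case: {-}_ / boolP => [xI|xI'].
    by case/negP: (etrans (esym (in_setC x I)) xC).
  by congr (inr (h' _)); apply: val_inj.
split.
  apply/pictureP; exists k; split.
  - case=> x; rewrite ffunE /=.
      by rewrite (kI _ (valP (g x))) (_ : Sub _ _ = g x) ?gK //; apply: val_inj.
    by rewrite (kC _ (valP (h x))) (_ : Sub _ _ = h x) ?hK //; apply: val_inj.
  - move=> x; case: (boolP (x \in I)) => [xI | /inC xC].
      by rewrite (kI x xI) ffunE /= g'K.
    by rewrite (kC x xC) ffunE /= h'K.
  - move=> [x|x] [y|y]; rewrite lt1_mk //= !ffunE /=.
      by move/g1; rewrite lt2_mk.
    by move/h1; rewrite lt2_mk.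
  - move=> x y xy; rewrite lt2_mk.
    case: (boolP (x \in I)) => [xI | /inC xC]; case: (boolP (y \in I)) => [yI | /inC yC].
    + by rewrite (kI x xI) (kI y yI) /=; apply: g2; rewrite lt1_mk.
    + by rewrite (kI x xI) (kC y yC).
    + by move: xC; rewrite inE (lowI x y).
    + by rewrite (kC x xC) (kC y yC) /=; apply: h2; rewrite lt1_mk.
apply/setP => x; apply/imsetP/idP => [[t _ ->] | xI].
  by rewrite ffunE; apply: valP.
by exists (g' (Sub x xI)); rewrite // ffunE /= g'K.
Qed.

(** Since f is injective and sends the left factor onto I, it sends the right
    factor onto the complement of I, so both restrictions are bijections. *)
Lemma picture_unglue f :
    picture (dcomp P Q) R f -> [set f (inl x) | x : T] = I ->
  exists g h, [/\ f = glue (g, h), picture P (drestr R I) g &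
                  picture Q (drestr R (~: I)) h].
Proof.
move=> /pictureP[k [fK kK f1 f2]] fI.
have fT x : f (inl x) \in I by rewrite -fI; apply: imset_f.
have fU y : f (inr y) \in ~: I.
  by rewrite inE -fI; apply/imsetP => -[x _ /(can_inj fK)].
have kT x (xI : x \in I) : exists t, f (inl t) == x.
  by move: xI; rewrite -fI => /imsetP[t _ ->]; exists t.
have kU x (xC : x \in ~: I) : exists u, f (inr u) == x.
  move: xC; rewrite inE -fI => xC; case E : (k x) => [t|u].
    by case/imsetP: xC; exists t; rewrite // -E kK.
  by exists u; rewrite -E kK.
have kTK x xI : f (inl (xchoose (kT x xI))) = x by apply/eqP/(xchooseP (kT x xI)).
have kUK x xC : f (inr (xchoose (kU x xC))) = x by apply/eqP/(xchooseP (kU x xC)).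
exists [ffun x => Sub (f (inl x)) (fT x)], [ffun y => Sub (f (inr y)) (fU y)].
split.
- by apply/ffunP => -[x|y]; rewrite !ffunE.
- apply/pictureP; exists (fun v => xchoose (kT (val v) (valP v))); split.
  + move=> x; rewrite ffunE.
    have := kTK _ (valP (Sub (f (inl x)) (fT x) : {v | v \in I})).
    by rewrite [in RHS]SubK => /(can_inj fK)[].
  + by move=> v; apply: val_inj; rewrite ffunE /= kTK.
  + by move=> x y xy; rewrite !ffunE lt2_mk; apply: f1; rewrite lt1_mk.
  + move=> v w; rewrite lt1_mk -{1}(kTK _ (valP v)) -{1}(kTK _ (valP w)) => /f2.
    by rewrite !fK lt2_mk.
- apply/pictureP; exists (fun v => xchoose (kU (val v) (valP v))); split.
  + move=> x; rewrite ffunE.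
    have := kUK _ (valP (Sub (f (inr x)) (fU x) : {v | v \in ~: I})).
    by rewrite [in RHS]SubK => /(can_inj fK)[].
  + by move=> v; apply: val_inj; rewrite ffunE /= kUK.
  + by move=> x y xy; rewrite !ffunE lt2_mk; apply: f1; rewrite lt1_mk.
  + move=> v w; rewrite lt1_mk -{1}(kUK _ (valP v)) -{1}(kUK _ (valP w)) => /f2.
    by rewrite !fK lt2_mk.
Qed.

End Glue.

(** An element below the image of the left factor has its preimage below the
    left factor for the second order, hence in the left factor. *)
Lemma picture_lower f :
  picture (dcomp P Q) R f -> lower_ideal R [set f (inl x) | x : T].
Proof.
move=> /pictureP[k [fK kK f1 f2]]; apply/lower_idealP => x _ /imsetP[t _ ->] /f2.
rewrite fK lt2_mk; case E : (k x) => [s|//] _.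
by apply/imsetP; exists s; rewrite // -E kK.
Qed.

(** Self-duality on basis elements: pictures are sorted by the image of the left
    factor, and those with image I are the pairs counted by the I-th term. *)
Lemma npictures_dcomp :
  npictures (dcomp P Q) R =
  (\sum_(I : {set V} | lower_ideal R I)
     npictures P (drestr R I) * npictures Q (drestr R (~: I)))%N.
Proof.
rewrite {1}/npictures -sum1_card.
rewrite (partition_big (fun f : {ffun _} => [set f (inl x) | x : T]) (lower_ideal R)) /=;
  last by move=> f; rewrite inE; apply: picture_lower.
apply: eq_bigr => I lowI.
rewrite sum1dep_card -cardsX -(card_imset _ (@glue_inj I)).
apply: eq_card => f; rewrite !inE; apply/andP/imsetP.
  move=> -[fP /eqP fI]; have [g [h [fE gP hP]]] := picture_unglue fP fI.
  by exists (g, h); rewrite // !inE gP.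
move=> [[g h]]; rewrite !inE /= => /andP[gP hP] ->.
by have [-> ->] := glue_picture gP hP lowI.
Qed.

End Pictures.

(** * The Hopf algebra of double posets *)

Local Notation ZD := {malg int[dclass]}.

Lemma zd_mulD : biadditive zd_mul.
Proof.
split=> [b|a] x y; first exact: linD.
by rewrite /zd_mul -lin_sumf; apply: eq_lin => k; exact: linD.
Qed.

Lemma zd_deltaD : {morph zd_delta : a b / a + b}.
Proof. exact: linD. Qed.

Lemma zd_counitD : {morph zd_counit : a b / a + b}.
Proof. exact: linD. Qed.

Lemma zd_basis x : << x >> = zd (drepr x) :> ZD.
Proof. by rewrite /zd dreprK. Qed.

Lemma tens_zd (T U : finType) (P : dposet T) (Q : dposet U) :
  zd P \ot zd Q = << (dcls P, dcls Q) >>.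
Proof. exact: tensU. Qed.

Lemma tassoc_zd (T U V : finType) (P : dposet T) (Q : dposet U) (R : dposet V) :
  tassoc (zd P \ot (zd Q \ot zd R)) = zd P \ot zd Q \ot zd R.
Proof. exact: tassocU. Qed.

Lemma zd_grade_zd (T : finType) (P : dposet T) n : #|T| = n -> zd_grade n (zd P).
Proof. by move=> Tn; apply: supportedU; rewrite dsize_cls. Qed.

Lemma zd_gradeM i j a b :
  zd_grade i a -> zd_grade j b -> zd_grade (i + j) (zd_mul a b).
Proof.
move=> ai bj; apply: (supported_lin ai) => x xi; apply: (supported_lin bj) => y yj.
by apply: zd_grade_zd; rewrite card_sum !card_ord xi yj.
Qed.

Lemma zd_delta_supported n a :
  zd_grade n a -> supported (fun p => dsize p.1 + dsize p.2 = n)%N (zd_delta a).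
Proof.
move=> an; apply: (supported_lin an) => x xn; apply: supported_sum => I _.
rewrite tens_zd; apply: supportedU.
by rewrite /= !dsize_drestr cardsC card_ord.
Qed.

Lemma zd_counit_grade n a : zd_grade n a -> n <> 0%N -> zd_counit a = 0.
Proof.
move=> an n0; rewrite /zd_counit /lin big1_seq // => x /andP[_ /an xn].
case: eqP => [x0|_]; last by rewrite mul0rz.
by case: n0; rewrite -xn x0 dsize_cls card_void.
Qed.

(* From here on these maps are used through their values on double posets. *)
Local Opaque dcls zd zd_mul zd_delta zd_counit.

Lemma zd_algebra : is_algebra zd_mul zd_one.
Proof.
apply: (algebra_on_basis zd_mulD) => [x y z|x|x]; rewrite !zd_basis.
- rewrite [X in zd_mul _ X = _]zd_mulE [LHS]zd_mulE.
  by rewrite [X in _ = zd_mul X _]zd_mulE [RHS]zd_mulE (zd_iso (dcompA _ _ _)).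
- by rewrite zd_mulE -(zd_iso (dcomp0P _)).
- by rewrite zd_mulE -(zd_iso (dcompP0 _)).
Qed.

Lemma tlift_zd (M : zmodType) (h : ZD -> ZD -> M) (T U : finType)
  (P : dposet T) (Q : dposet U) : tlift h (zd P \ot zd Q) = h (zd P) (zd Q).
Proof. by rewrite tens_zd tliftU. Qed.

Lemma tlift_delta (M : zmodType) (h : ZD -> ZD -> M) (T : finType) (P : dposet T) :
  tlift h (zd_delta (zd P)) =
  \sum_(I : {set T} | lower_ideal P I) h (zd (drestr P I)) (zd (drestr P (~: I))).
Proof.
rewrite zd_deltaE /decompositions (morph_sum _ _ _ (tliftD h)).
by apply: eq_bigr => I _; rewrite tlift_zd.
Qed.

(** The coproduct of a restriction, indexed by subsets of the ambient set, so
    that the iterated coproducts become double sums over subsets. *)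
Lemma zd_delta_drestr (T : finType) (P : dposet T) (I : {set T}) :
  zd_delta (zd (drestr P I)) =
  \sum_(A : {set T} | (A \subset I) && lower_in P I A)
     zd (drestr P A) \ot zd (drestr P (I :\: A)).
Proof.
rewrite zd_deltaE /decompositions.
rewrite [RHS](reindex_onto (fun J : {set {x | x \in I}} => val @: J)
  (fun A : {set T} => [set u | val u \in A])) /=; last first.
  move=> A /andP[/subsetP AI _]; apply/setP => x; apply/imsetP/idP.
    by move=> [u]; rewrite inE => uA ->.
  by move=> xA; exists (Sub x (AI x xA)); rewrite ?inE.
apply: eq_big => [J | J _].
  rewrite lower_ideal_drestr.
  have -> : [set u | val u \in val @: J] = J.
    by apply/setP => u; rewrite inE (mem_imset _ _ val_inj).
  rewrite eqxx andbT.
  have -> // : val @: J \subset I.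
  by apply/subsetP => _ /imsetP[u _ ->]; apply: valP.
rewrite (zd_iso (drestr_drestr P J)) (zd_iso (drestr_drestr P (~: J))).
congr (_ \ot zd (drestr P _)).
apply/setP => x; rewrite inE; apply/imsetP/andP.
  move=> [u]; rewrite inE => uJ ->; split; last exact: valP.
  by rewrite (mem_imset _ _ val_inj).
move=> [xJ xI]; exists (Sub x xI) => //; rewrite inE.
by apply: contra xJ => /(imset_f val).
Qed.

(** Both sides are the sum, over chains B <= A of lower ideals of P, of the
    tensor of P|B, P|(A minus B) and P|(complement of A).  On the left A is
    chosen first; on the right B is, and A is the union of B and the second
    ideal. *)
Lemma zd_coassoc (T : finType) (P : dposet T) :
    tlift (fun b c => zd_delta b \ot c) (zd_delta (zd P))
    = tassoc (tlift (fun b c => b \ot zd_delta c) (zd_delta (zd P))).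
Proof.
have assocD : {morph @tassoc dclass : a b / a + b} by exact: tliftD.
rewrite !tlift_delta (morph_sum _ _ _ assocD).
pose F (B A : {set T}) :=
  zd (drestr P B) \ot zd (drestr P (A :\: B)) \ot zd (drestr P (~: A)).
transitivity (\sum_(A : {set T} | lower_ideal P A)
    \sum_(B : {set T} | (B \subset A) && lower_in P A B) F B A).
  apply: eq_bigr => A _; rewrite zd_delta_drestr.
  exact: (morph_sum _ _ _ (tensD.1 _)).
(* Sum over B first on the left as well. *)
rewrite (exchange_big_dep (lower_ideal P)) /=; last first.
  by move=> A B lowA BA; have := lower_chain P A B; rewrite lowA BA => /esym/andP[].
apply: eq_bigr => B lowB.
rewrite zd_delta_drestr (morph_sum _ _ _ (tensD.2 _)) (morph_sum _ _ _ assocD).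
rewrite (reindex_onto (fun C => B :|: C) (fun A => A :\: B)) /=; last first.
  move=> A; rewrite lower_chain => /and3P[_ BA _].
  by rewrite setDE setUIr setUCr setIT; apply/setUidPr.
apply: eq_big => [C | C /andP[_ /eqP CB]].
  rewrite lower_chain lowB subsetUl /= lower_idealU // setDUl setDv set0U setDE.
  rewrite (sameP eqP setIidPl).
  by have [/setIidPl->|_] := boolP (C \subset ~: B); rewrite ?andbT ?andbF.
rewrite tassoc_zd /F CB; congr (_ \ot zd (drestr P _)).
by rewrite setCU setDE.
Qed.

Lemma drestr_set0_card (T : finType) (I : {set T}) :
  (#|{: {x | x \in I}}| == 0)%N = (I == set0).
Proof.
by rewrite card_sig -(cards_eq0 I); congr (_ == _); apply: eq_card => x; rewrite inE.
Qed.

Lemma zd_coalgebra : is_coalgebra zd_delta zd_counit.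
Proof.
split; [exact: zd_deltaD | exact: zd_counitD | | |].
- by apply: (coassoc_on_basis zd_deltaD) => x; rewrite zd_basis zd_coassoc.
- apply: (tlift_on_basis zd_deltaD) => x; rewrite zd_basis tlift_delta.
  rewrite (bigD1 set0) /=; last by apply/lower_idealP => u v; rewrite inE.
  rewrite big1 => [|I /andP[_ I0]]; last first.
    by rewrite zd_counitE drestr_set0_card (negbTE I0) mulr0z.
  by rewrite zd_counitE drestr_set0_card eqxx mulr1z addr0 setC0 (zd_iso (drestrT _)).
- apply: (tlift_on_basis zd_deltaD) => x; rewrite zd_basis tlift_delta.
  rewrite (bigD1 setT) /=; last by apply/lower_idealP => u v; rewrite inE.
  rewrite big1 => [|I /andP[_ IT]]; last first.
    rewrite zd_counitE drestr_set0_card -setCT (inj_eq (@setC_inj _)).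
    by rewrite (negbTE IT) mulr0z.
  by rewrite zd_counitE drestr_set0_card setCT eqxx mulr1z addr0 (zd_iso (drestrT _)).
Qed.

Lemma zd_delta_dcomp (T U : finType) (P : dposet T) (Q : dposet U) :
  zd_delta (zd (dcomp P Q)) = tmul zd_mul (zd_delta (zd P)) (zd_delta (zd Q)).
Proof.
rewrite [LHS]zd_deltaE /decompositions /tmul [RHS]tlift_delta.
under [RHS]eq_bigr do rewrite tlift_delta.
rewrite pair_big /= (reindex (fun p : {set _} * {set _} => sum_set p.1 p.2)) /=;
    last first.
  exists (fun K : {set T + U} => ([set x | inl x \in K], [set y | inr y \in K])).
    by move=> [I J] _; congr (_, _); apply/setP => u; rewrite inE in_sum_set.
  by move=> K _; apply/setP => -[u|u]; rewrite in_sum_set inE.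
apply: eq_big => [[I J] | [I J] _] /=; first exact: lower_ideal_dcomp.
rewrite setC_sum_set [X in _ = X \ot _]zd_mulE [X in _ = _ \ot X]zd_mulE.
by apply: (congr2 (@tens _ _)); apply/esym/zd_iso/drestr_dcomp.
Qed.

Lemma zd_deltaM a b : zd_delta (zd_mul a b) = tmul zd_mul (zd_delta a) (zd_delta b).
Proof.
move: a b; apply: (morphism_on_basis zd_mulD (tmulD _) zd_deltaD) => x y.
rewrite (zd_basis x) (zd_basis y) [X in zd_delta X = _]zd_mulE.
exact: zd_delta_dcomp.
Qed.

Lemma zd_card0 (T : finType) (P : dposet T) : #|T| = 0%N -> zd P = zd_one.
Proof.
move=> T0; apply: zd_iso; have TF (x : T) : False by have := card0_eq T0 x.
apply: (@diso_bij _ _ _ _ (fun x => match TF x with end)) => [x|[]|x|x];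
  by case: (TF x).
Qed.

Lemma zd_delta1 : zd_delta zd_one = zd_one \ot zd_one.
Proof.
rewrite zd_deltaE /decompositions (big_pred1 set0) => [|I].
  by apply: (congr2 (@tens _ _)); apply: zd_card0; apply: eq_card0 => -[[]].
have -> : I = set0 by apply/setP; case.
by rewrite /= eqxx; apply/lower_idealP; case.
Qed.

Lemma zd_bialgebra : is_bialgebra zd_mul zd_one zd_delta zd_counit.
Proof.
split; [exact: zd_algebra | exact: zd_coalgebra | exact: zd_deltaM |
        exact: zd_delta1 | | by rewrite zd_counitE card_void].
apply: (morphism_on_basis zd_mulD _ zd_counitD) => [|x y].
  by split=> [b|a] c d; [exact: mulrDl | exact: mulrDr].
rewrite (zd_basis x) (zd_basis y) [X in zd_counit X = _]zd_mulE [LHS]zd_counitE.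
rewrite [X in _ = X * _]zd_counitE [X in _ = _ * X]zd_counitE card_sum addn_eq0.
by case: (_ == _); case: (_ == _).
Qed.

(** The empty double poset is the only one of size 0. *)
Lemma zd_connected a : zd_grade 0 a -> a = zd_one *~ zd_counit a.
Proof.
have epsD : {morph zd_counit : a b / a + b} by exact: linD.
move=> a0; apply: (eq_on_support (f := id)
  (g := fun a => zd_one *~ zd_counit a) _ _ a0) => // [x y|x x0].
  by rewrite epsD mulrzDr.
have x_card0 : #|'I_(dsize x)| = 0%N by rewrite card_ord.
by rewrite zd_basis zd_counitE x_card0 mulr1z; apply: zd_card0.
Qed.

Lemma zd_graded_hopf :
  is_graded_hopf_algebra zd_mul zd_one zd_delta zd_counit zd_grade.
Proof.
have gr1 : zd_grade 0 zd_one by apply: zd_grade_zd; rewrite card_void.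
split.
- exact: zd_bialgebra.
- exact: supported_grading.
- exact: zd_gradeM.
- exact: gr1.
- by move=> n a /zd_delta_supported; apply: supported_tgr.
- exact: zd_counit_grade.
- exact: (takeuchi_antipode zd_bialgebra zd_gradeM gr1 zd_delta_supported
    zd_counit_grade zd_connected).
Qed.

Lemma zd_pair_mul (T U V : finType) (E : dposet T) (F : dposet U) (G : dposet V) :
  zd_pair (zd_mul (zd E) (zd F)) (zd G) = zd_pair2 (zd E \ot zd F) (zd_delta (zd G)).
Proof.
rewrite zd_mulE zd_pairE npictures_dcomp /zd_pair2 tlift_zd tlift_delta.
rewrite (big_morph Posz PoszD (erefl _)).
apply: eq_bigr => I _; rewrite PoszM.
by rewrite [X in _ = X * _]zd_pairE [X in _ = _ * X]zd_pairE.
Qed.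

Theorem theorem2p1 :
  is_graded_hopf_algebra zd_mul zd_one zd_delta zd_counit zd_grade /\
  (forall (T U V : finType) (E : dposet T) (F : dposet U) (G : dposet V),
     zd_pair (zd_mul (zd E) (zd F)) (zd G)
     = zd_pair2 (zd E \ot zd F) (zd_delta (zd G))).
Proof. split; [exact: zd_graded_hopf | exact: zd_pair_mul]. Qed.
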